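(* Let $n,m,T\ge 1$, $1<p<\infty$, $q=p/(p-1)$, $\epsilon>0$ and $\beta>0$. Let $\mathcal L_1,\dots,\mathcal L_m:\mathbb{R}^n\to\mathbb{R}$ be differentiable, and assume that the total loss $\mathcal L(\theta):=\sum_{i=1}^m\mathcal L_i(\theta)$ is $\beta$-smooth with respect to the $\ell_q$ norm, i.e. $$\mathcal L(\theta')\le\mathcal L(\theta)+\nabla\mathcal L(\theta)^\top(\theta'-\theta)+\frac{\beta}{2}\|\theta'-\theta\|_q^2\qquad\text{for all }\theta,\theta'\in\mathbb{R}^n .$$ Let $\{\theta_t\}_{t=0}^T$ be the sequence generated from an initial point $\theta_0\in\mathbb{R}^n$ by the DualChebyshev algorithm (described in the context) with norm parameter $p$, threshold $\epsilon$ and constant step size $\eta_t=\eta=1/\beta$, where $\nabla\mathcal L_i(\theta_t)\neq 0$ for every $i$ and every iterate $\theta_t$ at which gradients are normalized. Let $\theta^\star\in\mathbb{R}^n$ be a point satisfying $\mathcal L(\theta^\star)\le\mathcal L(\theta_t)$ for all $t$. Then the sequence either terminates at an $\epsilon$-Pareto-stationary point, or satisfies $$\min_{0\le t\le T-1}\|\nabla\mathcal L(\theta_t)\|_p^2\le\frac{2\beta\bigl(\mathcal L(\theta_0)-\mathcal L(\theta^\star)\bigr)}{\epsilon^2T} .$$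
   Context: $\|\cdot\|_p$ and $\|\cdot\|_q$ denote the $\ell_p$ and $\ell_q$ norms on $\mathbb{R}^n$. Write $g_i(\theta)=\nabla\mathcal L_i(\theta)$ and, when $g_i(\theta)\ne0$, $\hat g_i^{(p)}(\theta)=g_i(\theta)/\|g_i(\theta)\|_p$. Let $\Delta^m=\{\alpha\in\mathbb{R}^m:\alpha_i\ge 0,\ \sum_i\alpha_i=1\}$. The operations $\operatorname{sgn}$, $|\cdot|$ and powers are applied componentwise to vectors, and $\odot$ is componentwise multiplication. DualChebyshev algorithm (with parameters $p\in(1,\infty)$, step sizes $\eta_t$, threshold $\epsilon>0$, initial point $\theta_0$). For $t=0,1,\dots,T-1$: (1) let $\alpha_t\in\Delta^m$ be an optimal solution of $\min_{\alpha\in\Delta^m}\|\sum_{i=1}^m\alpha_i\hat g_i^{(p)}(\theta_t)\|_p$; (2) set $w_t=\sum_{i=1}^m\alpha_{t,i}\hat g_i^{(p)}(\theta_t)$; (3) if $\|w_t\|_p\le\epsilon$, terminate and return $\theta_t$; (4) otherwise set $v_t=\operatorname{sgn}(w_t)\odot|w_t|^{p-1}/\|w_t\|_p^{p-1}$; (5) set $d_t=\bigl(\sum_{i=1}^m g_i(\theta_t)^\top v_t\bigr)v_t$; (6) set $\theta_{t+1}=\theta_t-\eta_t d_t$. If no termination occurs, return $\theta_T$. A point $\theta$ (with all $g_i(\theta)\neq 0$) is called $\epsilon$-Pareto-stationary if the optimal value $r^\star$ of the problem $$\max_{v\in\mathbb{R}^n,\,r\in\mathbb{R}}\ r\quad\text{s.t.}\quad(\hat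 g_i^{(p)}(\theta))^\top v\ge r,\ i=1,\dots,m,\quad\|v\|_q\le1$$ satisfies $r^\star\le\epsilon$. *)

(* Defs.v *)
From HB Require Import structures.
From mathcomp Require Export all_boot all_order all_algebra.
From mathcomp Require Export all_classical all_reals all_analysis.

Set Implicit Arguments.
Unset Strict Implicit.
Unset Printing Implicit Defensive.

Export Order.TTheory GRing.Theory Num.Theory.
Export numFieldNormedType.Exports.

Local Open Scope classical_set_scope.
Local Open Scope ring_scope.

Definition dotp (R : realType) (n : nat) (u v : 'rV[R]_n) : R :=
  \sum_(j < n) u 0 j * v 0 j.

(* Written `lpnorm p` because `|x| on 'rV[R]_n is the sup norm. *)
Definition lpnorm (R : realType) (n : nat) (p : R) (x : 'rV[R]_n) : R :=
  (\sum_(j < n) `|x 0 j| `^ p) `^ p^-1.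

Definition gradient (R : realType) (n : nat) (f : 'rV[R]_n -> R)
    (theta : 'rV[R]_n) : 'rV[R]_n :=
  \row_(j < n) 'D_(delta_mx 0 j) f theta.

Definition total_loss (R : realType) (m n : nat)
    (L : 'I_m -> 'rV[R]_n -> R) (theta : 'rV[R]_n) : R :=
  \sum_(i < m) L i theta.

Definition smooth_wrt (R : realType) (n : nat) (q beta : R)
    (f : 'rV[R]_n -> R) : Prop :=
  forall theta theta' : 'rV[R]_n,
    f theta' <= f theta + dotp (gradient f theta) (theta' - theta)
                + beta / 2 * lpnorm q (theta' - theta) ^+ 2.

Definition simplex (R : realType) (m : nat) : set 'rV[R]_m :=
  [set a | (forall i, 0 <= a 0 i) /\ \sum_(i < m) a 0 i = 1].

Definition ngrad (R : realType) (n : nat) (p : R) (f : 'rV[R]_n -> R)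
    (theta : 'rV[R]_n) : 'rV[R]_n :=
  (lpnorm p (gradient f theta))^-1 *: gradient f theta.

Definition ngrad_comb (R : realType) (m n : nat) (p : R)
    (L : 'I_m -> 'rV[R]_n -> R) (theta : 'rV[R]_n) (a : 'rV[R]_m) : 'rV[R]_n :=
  \sum_(i < m) a 0 i *: ngrad p (L i) theta.

Definition optimal_weights (R : realType) (m n : nat) (p : R)
    (L : 'I_m -> 'rV[R]_n -> R) (theta : 'rV[R]_n) (a : 'rV[R]_m) : Prop :=
  simplex a /\
  forall b, simplex b ->
    lpnorm p (ngrad_comb p L theta a) <= lpnorm p (ngrad_comb p L theta b).

Definition dual_vector (R : realType) (n : nat) (p : R)
    (w : 'rV[R]_n) : 'rV[R]_n :=
  (lpnorm p w `^ (p - 1))^-1 *: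
    \row_(j < n) (Num.sg (w 0 j) * `|w 0 j| `^ (p - 1)).

Definition update_direction (R : realType) (m n : nat)
    (L : 'I_m -> 'rV[R]_n -> R) (theta v : 'rV[R]_n) : 'rV[R]_n :=
  (\sum_(i < m) dotp (gradient (L i) theta) v) *: v.

(* The algorithm may pick any minimiser alpha_t, so it is a relation.  A run
   with horizon T stops at time N <= T: N < T means that the test
   ||w_N||_p <= eps succeeded at time N, and N = T that it never did.  The
   iterates are theta_0, ..., theta_N, the weights are computed at the times
   t <= N with t < T, and the values of theta and alpha at other times are
   irrelevant. *)
Record dual_chebyshev (R : realType) (m n : nat) (p eps : R) (eta : nat -> R)
    (L : 'I_m -> 'rV[R]_n -> R) (theta0 : 'rV[R]_n) (T N : nat)
    (theta : nat -> 'rV[R]_n) (alpha : nat -> 'rV[R]_m) : Prop :=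
  DualChebyshev {
    dc_init : theta 0%N = theta0;
    dc_horizon : (N <= T)%N;
    dc_weights : forall t, (t <= N)%N -> (t < T)%N ->
      optimal_weights p L (theta t) (alpha t);
    dc_continue : forall t, (t < N)%N ->
      eps < lpnorm p (ngrad_comb p L (theta t) (alpha t));
    dc_stop : (N < T)%N ->
      lpnorm p (ngrad_comb p L (theta N) (alpha N)) <= eps;
    dc_step : forall t, (t < N)%N ->
      let w := ngrad_comb p L (theta t) (alpha t) in
      let v := dual_vector p w in
      theta t.+1 = theta t - eta t *: update_direction L (theta t) v }.

Definition pareto_feasible (R : realType) (m n : nat) (p q : R)
    (L : 'I_m -> 'rV[R]_n -> R) (theta : 'rV[R]_n) : set ('rV[R]_n * R) :=
  [set x | (forall i, x.2 <= dotp (ngrad p (L i) theta) x.1) /\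
           lpnorm q x.1 <= 1].

Definition pareto_value (R : realType) (m n : nat) (p q : R)
    (L : 'I_m -> 'rV[R]_n -> R) (theta : 'rV[R]_n) : \bar R :=
  ereal_sup [set (x.2)%:E | x in pareto_feasible p q L theta].

Definition pareto_stationary (R : realType) (m n : nat) (p q eps : R)
    (L : 'I_m -> 'rV[R]_n -> R) (theta : 'rV[R]_n) : Prop :=
  (forall i, gradient (L i) theta != 0) /\
  (pareto_value p q L theta <= eps%:E)%E.

(* The unit of the iterated minimum is its own first term u 0, so for T >= 1
   this is exactly min_{0 <= t <= T-1} u t. *)
Definition min_upto (R : realType) (T : nat) (u : nat -> R) : R :=
  \big[Num.min/u 0%N]_(t < T) u t.

(* Main.v *)
(* If the algorithm stops at [theta_N], Hoelder's inequality bounds the Pareto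
   value by [||w_N||_p <= eps] (weak duality).  Otherwise, the dual vector [v]
   of [w_t] satisfies [||v||_q = 1] and [<w_t, v> = ||w_t||_p], and first-order
   optimality of [alpha_t] gives [<ghat_i, v> >= ||w_t||_p > eps] for all [i].
   Hence [<grad L, v> >= eps * sum_i ||g_i||_p >= eps * ||grad L||_p], and with
   step 1/beta smoothness makes the loss decrease by at least
   [<grad L, v>^2 / (2 beta)]; these decreases telescope. *)
Require Import Defs.
From mathcomp Require Import ring lra.

Local Open Scope classical_set_scope.
Local Open Scope ring_scope.

(** * The pairing, [lpnorm], Hoelder's inequality and dual vectors *)

Section LpNorm.
Set Implicit Arguments.
Unset Strict Implicit.
Context {R : realType} {n : nat}.
Implicit Types (p q : R) (u v w x : 'rV[R]_n).

Lemma dotpDl u v w : dotp (u + v) w = dotp u w + dotp v w.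
Proof.
by rewrite -big_split; apply: eq_bigr => j _; rewrite mxE mulrDl.
Qed.

Lemma dotp0l w : dotp 0 w = 0.
Proof. by rewrite /dotp big1// => j _; rewrite mxE mul0r. Qed.

Lemma dotpZl a u w : dotp (a *: u) w = a * dotp u w.
Proof. by rewrite mulr_sumr; apply: eq_bigr => j _; rewrite mxE mulrA. Qed.

Lemma dotpC u v : dotp u v = dotp v u.
Proof. by apply: eq_bigr => j _; rewrite mulrC. Qed.

Lemma dotpZr a u w : dotp u (a *: w) = a * dotp u w.
Proof. by rewrite dotpC dotpZl dotpC. Qed.

Lemma dotp_suml m (u : 'I_m -> 'rV[R]_n) w :
  dotp (\sum_i u i) w = \sum_i dotp (u i) w.
Proof.
by rewrite exchange_big; apply: eq_bigr => j _; rewrite summxE mulr_suml.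
Qed.

Lemma lpnorm_ge0 p x : 0 <= lpnorm p x.
Proof. exact: powR_ge0. Qed.

Lemma lpnorm_powR p x : p != 0 -> lpnorm p x `^ p = \sum_(j < n) `|x 0 j| `^ p.
Proof.
move=> p0; rewrite -powRrM mulVf// powRr1//.
by apply: sumr_ge0 => j _; exact: powR_ge0.
Qed.

Lemma lpnorm0 p : p != 0 -> lpnorm p (0 : 'rV[R]_n) = 0.
Proof.
move=> p0; rewrite /lpnorm big1 ?powR0 ?invr_eq0// => j _.
by rewrite mxE normr0 powR0.
Qed.

Lemma lpnorm_eq0 p x : p != 0 -> (lpnorm p x == 0) = (x == 0).
Proof.
move=> p0; apply/eqP/eqP => [x0|->]; last exact: lpnorm0.
apply/rowP => j; rewrite mxE; apply/eqP.
have /eqP := lpnorm_powR x p0; rewrite x0 powR0// eq_sym psumr_eq0; last first.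
  by move=> i _; exact: powR_ge0.
by move=> /allP/(_ j); rewrite mem_index_enum powR_eq0 p0 andbT normr_eq0; apply.
Qed.

Lemma lpnorm_gt0 p x : p != 0 -> (0 < lpnorm p x) = (x != 0).
Proof. by move=> p0; rewrite lt_def lpnorm_ge0 lpnorm_eq0// andbT. Qed.

Lemma lpnormZ p a x : p != 0 -> lpnorm p (a *: x) = `|a| * lpnorm p x.
Proof.
move=> p0; have -> : `|a| = (`|a| `^ p) `^ p^-1.
  by rewrite -powRrM mulfV// powRr1.
rewrite /lpnorm -powRM ?powR_ge0//; last first.
  by apply: sumr_ge0 => j _; exact: powR_ge0.
congr (_ `^ _); rewrite mulr_sumr; apply: eq_bigr => j _.
by rewrite mxE normrM powRM.
Qed.

(** Young's inequality applied to the entries of [u] and [v] after scaling both to norm 1; zero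
    vectors, which cannot be scaled, are treated first. *)
Lemma dotp_hoelder p q u v : 0 < p -> 0 < q -> p^-1 + q^-1 = 1 ->
  dotp u v <= lpnorm p u * lpnorm q v.
Proof.
move=> p0 q0 pq; have [pN0 qN0] := (lt0r_neq0 p0, lt0r_neq0 q0).
have [->|uN0] := eqVneq u 0.
  by rewrite dotp0l mulr_ge0 ?lpnorm_ge0.
have [->|vN0] := eqVneq v 0.
  by rewrite dotpC dotp0l mulr_ge0 ?lpnorm_ge0.
have [a0 b0] : 0 < lpnorm p u /\ 0 < lpnorm q v.
  by split; [rewrite (lpnorm_gt0 _ pN0) | rewrite (lpnorm_gt0 _ qN0)].
move aE : (lpnorm p u) a0 => a a0; move bE : (lpnorm q v) b0 => b b0.
have normed r (c : R) (z : 'rV[R]_n) : r != 0 -> lpnorm r z = c -> 0 < c ->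
    \sum_(j < n) (`|z 0 j| / c) `^ r = 1.
  move=> r0 <- c0; under eq_bigr do rewrite powRM ?invr_ge0 ?(ltW c0)//.
  rewrite -mulr_suml -lpnorm_powR// -powRM ?invr_ge0 ?(ltW c0)//.
  by rewrite mulfV ?gt_eqF// powR1.
suff h : \sum_(j < n) (`|u 0 j| / a) * (`|v 0 j| / b) <= 1.
  have ab0 : 0 < a * b by exact: mulr_gt0.
  apply: le_trans (_ : a * b * _ <= _); last by apply: ler_piMr h; exact: ltW.
  rewrite mulr_sumr; apply: ler_sum => j _.
  have -> : a * b * (`|u 0 j| / a * (`|v 0 j| / b)) = `|u 0 j| * `|v 0 j|.
    by field; rewrite !gt_eqF.
  by rewrite -normrM ler_norm.
(* Writing 1 as the sum of the Young bounds reduces the claim to a coordinatewise one. *)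
have -> : 1 = \sum_(j < n) ((`|u 0 j| / a) `^ p / p + (`|v 0 j| / b) `^ q / q).
  by rewrite big_split /= -!mulr_suml normed// normed// !mul1r pq.
apply: ler_sum => j _.
by apply: conjugate_powR => //; rewrite divr_ge0// ltW.
Qed.

Lemma dotp_dual_vector p w : 1 < p -> dotp w (dual_vector p w) = lpnorm p w.
Proof.
move=> p1; have p0 : 0 < p by lra.
have [->|wN0] := eqVneq w 0.
  by rewrite dotp0l (lpnorm0 (lt0r_neq0 p0)).
have c0 : 0 < lpnorm p w by rewrite lpnorm_gt0// gt_eqF.
have cpN0 : lpnorm p w `^ (p - 1) != 0 by rewrite gt_eqF// powR_gt0.
rewrite dotpZr; apply: (mulfI cpN0).
rewrite mulVKf// mulrC mulr_powRB1 ?ltW// lpnorm_powR ?gt_eqF//.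
apply: eq_bigr => j _.
by rewrite mxE mulrA [w 0 j * _]mulrC -normrEsg mulr_powRB1.
Qed.

(** Since [(p - 1) * q = p], the [q]-th powers of the entries [|w_j|^(p-1)] sum to [||w||_p^p],
    which is the [q]-th power of the normalising factor. *)
Lemma lpnorm_dual_vector p q w : 1 < p -> q = p / (p - 1) -> w != 0 ->
  lpnorm q (dual_vector p w) = 1.
Proof.
move=> p1 qE wN0; have p0 : 0 < p by lra.
have c0 : 0 < lpnorm p w by rewrite lpnorm_gt0// gt_eqF.
have qp : (p - 1) * q = p by rewrite qE mulrCA mulfV ?mulr1// gt_eqF// subr_gt0.
have qN0 : q != 0 by apply: contra_eq_neq qp => ->; rewrite mulr0 lt_eqF.
rewrite lpnormZ// ger0_norm ?invr_ge0 ?powR_ge0//.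
have cpN0 : lpnorm p w `^ (p - 1) != 0 by rewrite gt_eqF// powR_gt0.
apply: (mulfI cpN0); rewrite mulr1 mulVKf//.
have q0 : 0 < q by rewrite qE divr_gt0 ?subr_gt0.
apply: (powR_injective q0); rewrite ?nnegrE.
- exact: lpnorm_ge0.
- exact: powR_ge0.
rewrite -powRrM qp; apply: etrans (lpnorm_powR _ qN0) _.
apply: etrans (esym (lpnorm_powR w (lt0r_neq0 p0))).
apply: eq_bigr => j _; rewrite mxE normrM normr_sg norm_powR// normr_id.
have [->|wj] := eqVneq (w 0 j) 0.
  by rewrite mul0r normr0 !powR0// gt_eqF.
by rewrite mul1r -powRrM qp.
Qed.

Lemma conjugate_exponents p q : 1 < p -> q = p / (p - 1) ->
  [/\ 0 < p, 0 < q & p^-1 + q^-1 = 1].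
Proof.
move=> p1 ->; have p0 : 0 < p by lra.
have p10 : 0 < p - 1 by lra.
by split; rewrite ?divr_gt0//; field; rewrite !gt_eqF.
Qed.

(** Minkowski by duality: the norm of [u + v] is its pairing with its own dual vector, which has
    unit [q]-norm, so Hoelder bounds the two summands separately. *)
Lemma lpnormD p u v : 1 < p -> lpnorm p (u + v) <= lpnorm p u + lpnorm p v.
Proof.
move=> p1; have [p0 q0 pq] := conjugate_exponents p1 erefl.
have [->|uvN0] := eqVneq (u + v) 0.
  by rewrite lpnorm0 ?gt_eqF// addr_ge0 ?lpnorm_ge0.
rewrite -dotp_dual_vector// dotpDl lerD//.
  by rewrite (le_trans (dotp_hoelder _ _ p0 q0 pq))// lpnorm_dual_vector ?mulr1.
by rewrite (le_trans (dotp_hoelder _ _ p0 q0 pq))// lpnorm_dual_vector ?mulr1.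
Qed.

Lemma lpnorm_sum p m (u : 'I_m -> 'rV[R]_n) : 1 < p ->
  lpnorm p (\sum_i u i) <= \sum_i lpnorm p (u i).
Proof.
move=> p1; have p0 : p != 0 by rewrite gt_eqF//; lra.
elim/big_ind2 : _ => [|x1 x2 y1 y2 h1 h2|//]; first by rewrite lpnorm0.
by rewrite (le_trans (lpnormD _ _ p1))// lerD.
Qed.

Lemma continuous_sg_powR (a : R) : 0 < a ->
  continuous (fun x : R => Num.sg x * `|x| `^ a).
Proof.
move=> a0; pose f (x : R) := Num.sg x * `|x| `^ a; rewrite -/f.
(* Near a positive point the signed power is the ordinary power; negative points will follow by
   oddness. *)
have f_pos (x : R) : 0 < x -> f y @[y --> x] --> f x.
  move=> x0; rewrite {2}/f gtr0_sg// mul1r gtr0_norm//.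
  apply: (@cvg_trans _ (y `^ a @[y --> x])); last first.
    suff : {for x, continuous (@powR R ^~ a)} by [].
    apply: differentiable_continuous; apply/derivable1_diffP.
    by apply: derivable_powR; rewrite in_itv/= andbT.
  apply: near_eq_cvg; near=> y.
  have y0 : 0 < y by near: y; exact: lt_nbhsr.
  by rewrite /f gtr0_sg// mul1r gtr0_norm.
move=> x; have [x0|x0|->] := ltgtP x 0; last 2 first.
- exact: f_pos.
- rewrite /continuous_at; have -> : f 0 = 0 by rewrite /f sgr0 mul0r.
  apply/cvgrPdist_lt => e e0; near=> y.
  (* At 0 this radius is chosen so that [|y|^a < e]. *)
  have ye : `|y| < e `^ a^-1.
    near: y; exists (e `^ a^-1) => [|z] /=; first exact: powR_gt0.
    by rewrite sub0r normrN.
  rewrite sub0r normrN /f normrM normr_sg norm_powR// normr_id.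
  have [->|yN0] := eqVneq y 0; first by rewrite mul0r.
  rewrite mul1r (_ : e = (e `^ a^-1) `^ a); last first.
    by rewrite -powRrM mulVf ?gt_eqF// powRr1// ltW.
  by apply: gt0_ltr_powR => //; rewrite nnegrE ?powR_ge0.
- rewrite /continuous_at; have fE (y : R) : f y = - f (- y) by rewrite /f sgrN normrN mulNr opprK.
  under eq_cvg do rewrite fE; rewrite fE.
  apply: cvgN; apply: (@cvg_comp _ _ _ -%R f _ (nbhs (- x))).
    exact: opp_continuous.
  by apply: f_pos; rewrite oppr_gt0.
Unshelve. all: by end_near. Qed.

(* The dual vector [v s] of [w + s u] satisfies
   [|w + s u| = <v s, w> + s <v s, u> <= |w| + s <v s, u>], so that
   [0 <= <v s, u>] for small [s > 0]; then let [s] tend to 0, using continuity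
   of [v] up to its positive normalising factor. *)
Lemma dual_vector_first_order p w u : 1 < p ->
  (forall s : R, 0 < s <= 1 -> lpnorm p w <= lpnorm p (w + s *: u)) ->
  0 <= dotp u (dual_vector p w).
Proof.
move=> p1 wmin; have [p0 q0 pq] := conjugate_exponents p1 erefl.
have pN0 := lt0r_neq0 p0.
pose f (x : R) := Num.sg x * `|x| `^ (p - 1).
pose psi (z : 'rV[R]_n) : 'rV[R]_n := \row_j f (z 0 j).
rewrite dotpZr mulr_ge0 ?invr_ge0 ?powR_ge0//.
rewrite -[X in dotp u X]/(psi w).
have cvg_psi : dotp u (psi (w + s *: u)) @[s --> 0^'+] --> dotp u (psi w).
  apply: cvg_big => [|j _]; first exact: add_continuous.
  apply: cvgMr; rewrite /psi; under eq_cvg do rewrite mxE; rewrite mxE.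
  apply: (@cvg_comp _ _ _ (fun s => (w + s *: u) 0 j) f _ (nbhs (w 0 j))).
    under eq_cvg do rewrite !mxE.
    apply: cvg_at_right_filter.
    have : w 0 j + s * u 0 j @[s --> (0 : R)] --> w 0 j + 0 * u 0 j.
      by apply: cvgD; [exact: cvg_cst|apply: cvgMl; exact: cvg_id].
    by rewrite mul0r addr0.
  by apply: continuous_sg_powR; rewrite subr_gt0.
apply: (cvgr_to_ge cvg_psi); near=> s.
have s0 : 0 < s by near: s; exact: nbhs_right_gt.
have s1 : s <= 1 by near: s; exact: nbhs_right_ltW.
set z := w + s *: u.
(* The dual vector of [z] has unit norm only for [z != 0]; at [z = 0] the pairing with [psi z]
   vanishes. *)
have [z0|zN0] := eqVneq z 0.
  by rewrite /dotp big1// => j _; rewrite z0 !mxE /f sgr0 mul0r mulr0.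
have c0 : 0 < (lpnorm p z `^ (p - 1))^-1.
  by rewrite invr_gt0 powR_gt0// (lpnorm_gt0 _ pN0).
(* Restoring the positive factors turns [psi z] into the dual vector and makes [s <u, v>] appear. *)
rewrite -(pmulr_rge0 _ c0) -dotpZr -/(dual_vector p z) -(pmulr_rge0 _ s0).
have := wmin s; rewrite s0 s1 => /(_ erefl); rewrite -/z -(dotp_dual_vector z p1).
rewrite {1}/z dotpDl dotpZl => h.
have := dotp_hoelder w (dual_vector p z) p0 q0 pq.
rewrite (lpnorm_dual_vector p1 erefl zN0) mulr1 => h'.
by rewrite -(lerD2l (lpnorm p w)) addr0 (le_trans h)// lerD2r.
Unshelve. all: by end_near. Qed.

End LpNorm.

(** * Weak duality, optimal weights and one-step descent *)

Section MultiObjective.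
Set Implicit Arguments.
Unset Strict Implicit.
Context {R : realType} {m n : nat} (L : 'I_m -> 'rV[R]_n -> R).
Implicit Types (p q eps : R) (th w v : 'rV[R]_n) (a : 'rV[R]_m).

Lemma gradient_total_loss th : (forall i, differentiable (L i) th) ->
  gradient (total_loss L) th = \sum_i gradient (L i) th.
Proof.
move=> dL; apply/rowP => j; rewrite summxE mxE.
have -> : total_loss L = \sum_(i < m) L i.
  by apply/funext => x; rewrite fct_sumE.
rewrite derive_sum => [|i]; first by apply: eq_bigr => i _; rewrite mxE.
exact: diff_derivable.
Qed.

(** Averaging the constraints on [r] with weights [a] leaves the single bound [r <= <w, v>], to
    which Hoelder applies with [||v||_q <= 1]. *)
Lemma pareto_value_le p q th a : 0 < p -> 0 < q -> p^-1 + q^-1 = 1 ->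
  simplex a ->
  (pareto_value p q L th <= (lpnorm p (ngrad_comb p L th a))%:E)%E.
Proof.
move=> p0 q0 pq [a0 a1]; apply: ge_ereal_sup => _ [[v r] [/= vr v1] <-].
rewrite lee_fin.
have -> : r = \sum_(i < m) a 0 i * r by rewrite -mulr_suml a1 mul1r.
apply: (@le_trans _ _ (dotp (ngrad_comb p L th a) v)).
  by rewrite dotp_suml; apply: ler_sum => i _; rewrite dotpZl ler_wpM2l.
apply: (le_trans (dotp_hoelder _ _ p0 q0 pq)).
by rewrite ler_piMr ?lpnorm_ge0.
Qed.

(** Shifting weight towards vertex [i] moves the combination along a segment towards the [i]-th
    normalised gradient, so optimality over the simplex yields a one-parameter perturbation. *)
Lemma ngrad_comb_vertex p th a i (s : R) :
  ngrad_comb p L th (a + s *: (delta_mx 0 i - a)) =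
  ngrad_comb p L th a + s *: (ngrad p (L i) th - ngrad_comb p L th a).
Proof.
have lin (c : R) (b d : 'rV[R]_m) : ngrad_comb p L th (b + c *: d) =
    ngrad_comb p L th b + c *: ngrad_comb p L th d.
  rewrite /ngrad_comb scaler_sumr -big_split; apply: eq_bigr => k _ /=.
  by rewrite !mxE scalerDl scalerA.
have vtx : ngrad_comb p L th (delta_mx 0 i) = ngrad p (L i) th.
  rewrite /ngrad_comb (bigD1 i)//= big1 ?addr0 ?mxE ?eqxx ?scale1r// => k ki.
  by rewrite mxE eqxx (negbTE ki) scale0r.
by rewrite lin -[- a]scaleN1r lin vtx scaleN1r.
Qed.

Lemma simplex_vertex a i (s : R) : 0 <= s <= 1 -> simplex a ->
  simplex (a + s *: (delta_mx 0 i - a)).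
Proof.
move=> /andP[s0 s1] [a0 a1]; split=> [k|].
  rewrite !mxE eqxx /=; have := a0 k; case: (k == i) => /=; nra.
under eq_bigr do rewrite !mxE eqxx /=.
rewrite big_split -mulr_sumr big_split sumrN a1 (bigD1 i)//= eqxx big1.
  by rewrite addr0 subrr mulr0 addr0.
by move=> k /negbTE ->.
Qed.

(** First-order optimality in the direction [ghat_i - w] gives [<ghat_i - w, v> >= 0], while
    [<w, v> = ||w||_p]. *)
Lemma lpnorm_le_dotp_ngrad p th a i : 1 < p -> optimal_weights p L th a ->
  lpnorm p (ngrad_comb p L th a) <=
  dotp (ngrad p (L i) th) (dual_vector p (ngrad_comb p L th a)).
Proof.
move=> p1 [sa amin]; set w := ngrad_comb p L th a.
rewrite -(dotp_dual_vector w p1) -subr_ge0 -mulN1r -dotpZl -dotpDl scaleN1r.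
apply: (dual_vector_first_order p1) => s /andP[s0 s1].
rewrite -ngrad_comb_vertex; apply: amin; apply: simplex_vertex => //.
by rewrite (ltW s0).
Qed.

Lemma eps_lpnorm_le_dotp p eps th a : 1 < p -> 0 < eps ->
  optimal_weights p L th a ->
  let w := ngrad_comb p L th a in eps < lpnorm p w ->
  eps * lpnorm p (\sum_i gradient (L i) th) <=
  \sum_i dotp (gradient (L i) th) (dual_vector p w).
Proof.
move=> p1 eps0 opt w epsw; have pN0 : p != 0 by rewrite gt_eqF//; lra.
apply: (@le_trans _ _ (\sum_i eps * lpnorm p (gradient (L i) th))).
  by rewrite -mulr_sumr (ler_wpM2l (ltW eps0))// lpnorm_sum.
apply: ler_sum => i _; set g := gradient (L i) th.
(* A zero gradient contributes 0 to both sides; otherwise the bound on [<ghat_i, v>] is multiplied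
   by [||g||_p]. *)
have [->|gN0] := eqVneq g 0.
  by rewrite (lpnorm0 pN0) mulr0 dotp0l.
have c0 : 0 < lpnorm p g by rewrite (lpnorm_gt0 _ pN0).
rewrite mulrC -ler_pdivlMl// -dotpZl -/(ngrad p (L i) th).
exact: (le_trans (ltW epsw) (lpnorm_le_dotp_ngrad i p1 opt)).
Qed.

(** Along [-v] with step length [t], smoothness bounds [f] by [f th - t s + beta t^2 / 2], where [s]
    is the slope; the algorithm takes the minimiser [t = s / beta], which gains [s^2 / (2 beta)]. *)
Lemma smooth_step q beta (f : 'rV[R]_n -> R) th v : q != 0 -> 0 < beta ->
  smooth_wrt q beta f -> lpnorm q v = 1 ->
  dotp (gradient f th) v ^+ 2 <=
  2 * beta * (f th - f (th - (1 / beta) *: (dotp (gradient f th) v *: v))).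
Proof.
move=> qN0 beta0 sm v1; set s := dotp _ v; have := sm th (th - (1 / beta) *: (s *: v)).
set th' := th - _; have -> : th' - th = - (s / beta) *: v.
  by rewrite /th' addrAC subrr add0r scalerA div1r scaleNr mulrC.
rewrite dotpZr -/s (lpnormZ _ _ qN0) v1 mulr1 normrN real_normK ?num_real//.
have -> : f th + - (s / beta) * s + beta / 2 * (s / beta) ^+ 2 =
    f th - s ^+ 2 / (2 * beta) by field; rewrite gt_eqF.
move=> h; rewrite -ler_pdivrMl ?mulr_gt0//; lra.
Qed.

End MultiObjective.

(** * From one-step descent to the rate *)

Lemma min_upto_le_sum (R : realType) (T : nat) (u : nat -> R) :
  T%:R * min_upto T u <= \sum_(t < T) u t.
Proof.
have -> : T%:R * min_upto T u = \sum_(t < T) min_upto T u.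
  by rewrite sumr_const card_ord mulr_natl.
by apply: ler_sum => t _; exact: bigmin_le.
Qed.

Theorem theorem3p8 (R : realType) (n m T : nat) (p q eps beta : R)
    (hn : (1 <= n)%N) (hm : (1 <= m)%N) (hT : (1 <= T)%N)
    (hp : 1 < p) (hq : q = p / (p - 1)) (heps : 0 < eps) (hbeta : 0 < beta)
    (L : 'I_m -> 'rV[R]_n -> R)
    (hdiff : forall (i : 'I_m) (x : 'rV[R]_n), differentiable (L i) x)
    (hsmooth : smooth_wrt q beta (total_loss L))
    (theta0 : 'rV[R]_n) (N : nat)
    (theta : nat -> 'rV[R]_n) (alpha : nat -> 'rV[R]_m)
    (hrun : dual_chebyshev p eps (fun _ => 1 / beta) L theta0 T N theta alpha)
    (hgrad : forall (t : nat) (i : 'I_m), (t <= N)%N -> (t < T)%N ->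
      gradient (L i) (theta t) != 0)
    (theta_star : 'rV[R]_n)
    (hstar : forall t : nat, (t <= N)%N ->
      total_loss L theta_star <= total_loss L (theta t)) :
  ((N < T)%N /\ pareto_stationary p q eps L (theta N)) \/
  (N = T /\
   min_upto T (fun t => lpnorm p (gradient (total_loss L) (theta t)) ^+ 2)
     <= 2 * beta * (total_loss L theta0 - total_loss L theta_star)
        / (eps ^+ 2 * T%:R)).
Proof.
have [p0 q0 pq] := conjugate_exponents hp hq.
have [th0 NT wt cont stop step] := hrun.
have [ltNT|leTN] := ltnP N T.
  left; split=> //; split=> [i|]; first exact: hgrad.
  have [sa _] := wt N (leqnn N) ltNT.
  apply: (le_trans (pareto_value_le L _ p0 q0 pq sa)).
  by rewrite lee_fin; exact: stop.
right; have NE : N = T by apply/eqP; rewrite eqn_leq NT.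
split=> //; subst N; clear NT leTN.
set F := total_loss L; set u := fun t => _.
have descent t : (t < T)%N ->
    eps ^+ 2 * u t <= 2 * beta * (F (theta t) - F (theta t.+1)).
  move=> tT; have opt := wt t (ltnW tT) tT; have epsw := cont t tT.
  have gradE := gradient_total_loss (fun i => hdiff i (theta t)).
  rewrite /u (step t tT) /update_direction.
  set w := ngrad_comb _ _ _ _ in epsw *; set v := dual_vector p w.
  have le_s := eps_lpnorm_le_dotp hp heps opt epsw.
  have wN0 : w != 0.
    by rewrite -(lpnorm_gt0 _ (lt0r_neq0 p0)) (lt_trans heps).
  have v1 : lpnorm q v = 1 by exact: lpnorm_dual_vector.
  have := smooth_step (theta t) (lt0r_neq0 q0) hbeta hsmooth v1.
  rewrite gradE dotp_suml; apply: le_trans.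
  (* Squaring [le_s] is legitimate because its smaller side, [eps] times a norm, is nonnegative. *)
  by rewrite -exprMn lerXn2r ?nnegrE ?(le_trans _ le_s)// mulr_ge0 ?lpnorm_ge0 ?ltW.
have T0 : 0 < T%:R :> R by rewrite ltr0n.
have e0 : 0 < eps ^+ 2 by rewrite exprn_gt0.
rewrite ler_pdivlMr ?mulr_gt0// mulrC -[leLHS]mulrA.
apply: (@le_trans _ _ (eps ^+ 2 * \sum_(t < T) u t)).
  by rewrite ler_pM2l// min_upto_le_sum.
rewrite mulr_sumr.
apply: (@le_trans _ _
    (\sum_(t < T) 2 * beta * (F (theta t) - F (theta t.+1)))).
  by apply: ler_sum => t _; exact: descent.
rewrite -mulr_sumr ler_pM2l ?mulr_gt0//.
rewrite -(big_mkord xpredT (fun t => F (theta t) - F (theta t.+1))).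
(* The losses decrease, so the telescoping sequence is [-F]; the last term [F (theta T)] is then
   bounded below by the value at [theta_star]. *)
rewrite (telescope_sumr_eq (fun t => - F (theta t)))//; last first.
  by move=> t _; rewrite opprK addrC.
by rewrite opprK addrC th0 lerD2l lerN2 hstar.
Qed.
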